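(* Let $\langle \pi, \equiv_\pi \rangle$ be an abstract semantics that is fair and strong smn. Then for every total computable function $h:\mathbb{N}\to\mathbb{N}$ and every arity $n\geq 1$ there exists an index $a\in\mathbb{N}$ such that $a \sim_\pi^n h(a)$, i.e. $\pi_a^{(n)} \equiv_\pi \pi_{h(a)}^{(n)}$.
   Context: Fix a Turing-complete programming model with a Gödel numbering of its programs; for $a,n\in\mathbb{N}$, $\phi_a^{(n)}:\mathbb{N}^n\rightharpoonup\mathbb{N}$ denotes the $n$-ary partial function computed by the $a$-th program, and every $n$-ary partial recursive function equals $\phi_a^{(n)}$ for some $a$ (write $\phi_a=\phi_a^{(1)}$). Let $\mathcal{F}$ denote the class of all partial functions $\mathbb{N}^n\rightharpoonup\mathbb{N}$, $n\in\mathbb{N}$. An abstract semantics is a pair $\langle\pi,\equiv_\pi\rangle$ where $\pi$ assigns to each index $a$ and arity $n$ a (not necessarily computable) partial function $\pi_a^{(n)}:\mathbb{N}^n\rightharpoonup\mathbb{N}$, and $\equiv_\pi$ is an equivalence relation on $\mathcal{F}$. The induced program equivalence is $a\sim_\pi^n b$ iff $\pi_a^{(n)}\equiv_\pi\pi_b^{(n)}$. The abstract semantics is strong smn if for all $m,n\ge 1$ there is a total computable $s:\mathbb{N}^{m+2}\to\mathbb{N}$ such that for all $a,b\in\mathbb{N}$ and $\vec x\in\mathbb{N}^m$: $\lambda\vec y.\,\pi_a^{(n+1)}(\phi_b^{(m)}(\vec x),\vec y)\equiv_\pi \pi_{s(a,b,\vec x)}^{(n)}$ (the left side is everywhere undefined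 if $\phi_b^{(m)}(\vec x)$ is undefined). It is fair if for every arity $n$ there is $u\in\mathbb{N}$ such that for all $a\in\mathbb{N}$: $\pi_a^{(n)}\equiv_\pi \lambda\vec y.\,\pi_u^{(n+1)}(a,\vec y)$. *)

(* Defs.v *)
From Corelib Require Import RelationClasses.
From mathcomp Require Import all_boot.

(* Partial functions N^n -> N, not necessarily computable; None is
   "undefined". *)
Definition pfun (n : nat) : Type := n.-tuple nat -> option nat.

Definition Fclass : Type := {n : nat & pfun n}.

Definition toF {n : nat} (f : pfun n) : Fclass := existT pfun n f.

(* Kleene's mu-recursive functions. In the last three clauses the function h
   is only constrained through its graph, because the result of minimisation
   has no constructive definition as an option-valued function.
   Primitive recursion is on the first argument; t lists the successive
   values h(0, x), ..., h(k, x). *)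
Inductive partial_recursive : forall {n : nat}, pfun n -> Prop :=
| PR_zero n : @partial_recursive n (fun _ => Some 0)
| PR_succ : @partial_recursive 1 (fun x => Some (thead x).+1)
| PR_proj n (i : 'I_n) : @partial_recursive n (fun x => Some (tnth x i))
| PR_comp m n (g : pfun m) (fs : 'I_m -> pfun n) (h : pfun n) :
    partial_recursive g ->
    (forall i, partial_recursive (fs i)) ->
    (forall x y, h x = Some y <->
       exists z : m.-tuple nat,
         (forall i, fs i x = Some (tnth z i)) /\ g z = Some y) ->
    partial_recursive h
| PR_prec n (f : pfun n) (g : pfun n.+2) (h : pfun n.+1) :
    partial_recursive f ->
    partial_recursive g ->
    (forall (k : nat) (x : n.-tuple nat) (y : nat),
       h [tuple of k :: x] = Some y <->
       exists t : nat -> nat,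
         [/\ f x = Some (t 0),
             forall i, i < k ->
               g [tuple of i :: t i :: x] = Some (t i.+1)
           & y = t k]) ->
    partial_recursive h
| PR_mu n (f : pfun n.+1) (h : pfun n) :
    partial_recursive f ->
    (forall (x : n.-tuple nat) (y : nat),
       h x = Some y <->
       f [tuple of y :: x] = Some 0 /\
       forall i, i < y -> exists v, f [tuple of i :: x] = Some v.+1) ->
    partial_recursive h.

Definition total_computable {n : nat} (f : n.-tuple nat -> nat) : Prop :=
  partial_recursive (fun x => Some (f x)).

Definition total_computable1 (h : nat -> nat) : Prop :=
  @total_computable 1 (fun x => h (thead x)).

(* A Turing-complete programming model seen through a numbering of its
   programs: phi M a n is the n-ary partial function computed by the a-th
   program, and the functions computed are exactly the partial recursive
   ones. *)
Record programming_model : Type := ProgrammingModel {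
  phi : nat -> forall n : nat, pfun n;
  phi_partial_recursive : forall a n, partial_recursive (phi a n);
  phi_complete : forall n (f : pfun n),
    partial_recursive f -> exists a, forall x, phi a n x = f x
}.

Record abstract_semantics : Type := AbstractSemantics {
  sem : nat -> forall n : nat, pfun n;
  sem_equiv : Fclass -> Fclass -> Prop;
  sem_equivP : Equivalence sem_equiv
}.

Definition prog_equiv (P : abstract_semantics) (n a b : nat) : Prop :=
  sem_equiv P (toF (sem P a n)) (toF (sem P b n)).

(* lambda y. f(v, y), where v may be undefined; it is then nowhere defined. *)
Definition plug {n : nat} (f : pfun n.+1) (v : option nat) : pfun n :=
  fun y => if v is Some k then f [tuple of k :: y] else None.

Definition strong_smn (M : programming_model) (P : abstract_semantics) : Prop :=
  forall m n : nat, 1 <= m -> 1 <= n ->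
  exists s : m.+2.-tuple nat -> nat,
    total_computable s /\
    forall (a b : nat) (x : m.-tuple nat),
      sem_equiv P (toF (plug (sem P a n.+1) (phi M b m x)))
                  (toF (sem P (s [tuple of a :: b :: x]) n)).

Definition fair (P : abstract_semantics) : Prop :=
  forall n : nat, exists u : nat, forall a : nat,
    sem_equiv P (toF (sem P a n)) (toF (plug (sem P u n.+1) (Some a))).

(* Main.v *)
Require Import Defs.
From mathcomp Require Import all_boot.

(* Let u be a fair index at arity n and s the strong smn function for m = 1.
   The map x |-> h (s (u, x, x)) is total computable, hence equal to phi_e for
   some e. At a := s (u, e, e), strong smn says that sem_a is equivalent to
   sem_u (phi_e e, -) = sem_u (h a, -), and fairness says that this is equivalent
   to sem_(h a). *)

(** Since every [fs i] is total, the tuple [z] in [PR_comp] can only be the tuple of their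
    values. *)
Lemma total_computable_comp (m n : nat) (g : m.-tuple nat -> nat)
    (fs : 'I_m -> n.-tuple nat -> nat) (f : n.-tuple nat -> nat) :
  total_computable g -> (forall i, total_computable (fs i)) ->
  (forall x, f x = g [tuple fs i x | i < m]) -> total_computable f.
Proof.
move=> g_comp fs_comp fE.
apply: (PR_comp m n _ (fun i x => Some (fs i x)) _ g_comp fs_comp) => x y.
split=> [[<-]|[z [fsz <-]]].
  exists [tuple fs i x | i < m]; split=> [i|]; last by rewrite fE.
  by rewrite tnth_mktuple.
rewrite fE; congr (Some (g _)); apply: eq_from_tnth => i.
by rewrite tnth_mktuple; case: (fsz i).
Qed.

Lemma total_computable_const (n c : nat) : @total_computable n (fun=> c).
Proof.
elim: c => [|c IHc]; first exact: PR_zero.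
apply: (@total_computable_comp 1 n _ (fun=> fun=> c) _ PR_succ) => // x.
by rewrite /thead tnth_mktuple.
Qed.

(** The argument serves both as a program index and as that program's input. *)
Lemma total_computable_diag (s : 3.-tuple nat -> nat) (u : nat) :
  total_computable s ->
  total_computable (fun x : 1.-tuple nat => s [tuple u; thead x; thead x]).
Proof.
move=> s_comp.
pose fs (i : 'I_3) (x : 1.-tuple nat) := tnth [tuple u; thead x; thead x] i.
apply: (total_computable_comp _ _ s fs) => // [|x].
  case=> [[|[|[|i]]] lti] //; first exact: total_computable_const.
  - exact: (PR_proj 1 ord0).
  - exact: (PR_proj 1 ord0).
by congr s; apply: eq_from_tnth => i; rewrite tnth_mktuple.
Qed.

Theorem mainTheorem1 (M : programming_model) (P : abstract_semantics)
    (P_fair : fair P) (P_smn : strong_smn M P)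
    (h : nat -> nat) (h_computable : total_computable1 h)
    (n : nat) (n_ge1 : 1 <= n) :
  exists a : nat, prog_equiv P n a (h a).
Proof.
have [u uP] := P_fair n.
have [s [s_comp sP]] := P_smn 1 n isT n_ge1.
have hs_comp : total_computable
    (fun x : 1.-tuple nat => h (s [tuple u; thead x; thead x])).
  apply: (total_computable_comp _ _ _ _ _ h_computable
            (fun=> total_computable_diag s u s_comp)) => x.
  by rewrite [in RHS]/thead tnth_mktuple.
have [e eP] := phi_complete M _ _ hs_comp.
(* Program [e] runs on its own index; by [eP] the result is defined, so [plug] feeds [h (s
   [tuple u; e; e])] to [sem P u n.+1]. *)
have := sP u e [tuple e]; rewrite eP /=.
have -> : [tuple of u :: e :: [tuple e]] = [tuple u; e; e] by apply: val_inj.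
set a := s _ => smn_a; exists a.
have [_ sym trans] := sem_equivP P.
apply: trans (sym _ _ (uP (h a))).
exact: sym.
Qed.
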